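(* Let $\mathcal{H}=\mathbb{R}^d$ and let $$f(x)=\sum_{k=1}^{m}\max_{i\in I_k}g_{ki}(x)+\sum_{l=1}^{s}\min_{j\in J_l}u_{lj}(x),\qquad I_k=\{1,\dots,p_k\},\quad J_l=\{1,\dots,q_l\},$$ where the functions $g_{ki},u_{lj}\colon\mathbb{R}^d\to\mathbb{R}$ are twice continuously differentiable. Suppose that there exist $M>m_0>0$ such that $$m_0\|y\|^2\le\langle y,\nabla^2g_{ki}(x)y\rangle\le M\|y\|^2,\qquad m_0\|y\|^2\le\langle y,\nabla^2u_{lj}(x)y\rangle\le M\|y\|^2$$ for any $x,y\in\mathbb{R}^d$ and for all $i\in I_k$, $k\in\{1,\dots,m\}$, $j\in J_l$, $l\in\{1,\dots,s\}$. Consider the quadratic regularization of the method of codifferential descent (QR-MCD) for the function $f$ with $\alpha_*\ge1$, $\nu_n\equiv+\infty$ and $\lim_{n\to\infty}\mu_n>0$, and suppose that a sequence $\{x_n\}$ generated by this method converges to a point $x^*$. Then $x^*$ is a point of strict local minimum of $f$, and there exist $c\in(0,1)$, $Q>0$ and $n_0\in\mathbb{N}$ such that for any $n\ge n_0$ $$f(x_{n+1})-f(x^* )\le c\,\big[f(x_n)-f(x^* )\big],\qquad\|x_{n+1}-x^*\|\le Q\,c^{n/2}.$$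
   Context: Put $g_k(x)=\max_{i\in I_k}g_{ki}(x)$, $u_l(x)=\min_{j\in J_l}u_{lj}(x)$, and for $\nu,\mu\in[0,+\infty]$ let $I_{k,\nu}(x)=\{i\in I_k\mid g_{ki}(x)\ge g_k(x)-\nu\}$, $J_{l,\mu}(x)=\{j\in J_l\mid u_{lj}(x)\le u_l(x)+\mu\}$. Define the finite subsets of $\mathbb{R}\times\mathbb{R}^d$ (Minkowski sums) $$\underline{d}_\nu f(x)=\sum_{k=1}^m\{(g_{ki}(x)-g_k(x),\nabla g_{ki}(x))\mid i\in I_{k,\nu}(x)\},\qquad\overline{d}_\mu f(x)=\sum_{l=1}^s\{(u_{lj}(x)-u_l(x),\nabla u_{lj}(x))\mid j\in J_{l,\mu}(x)\}.$$ QR-MCD for $f$ (unconstrained, i.e. over $\mathbb{R}^d$). Choose $\{\nu_n\},\{\mu_n\}\subset[0,+\infty]$, $\alpha_*\in(0,+\infty]$ and $x_0\in\mathbb{R}^d$ (if $\alpha_*=+\infty$, then $[0,\alpha_*]$ means $[0,+\infty)$). At iteration $n\ge0$: for every $z\in\overline{d}_{\mu_n}f(x_n)$ let $h_n(z)$ be the unique minimizer over $h\in\mathbb{R}^d$ of $$\varphi_n(h,z)=\max_{(a,v)\in\operatorname{co}\underline{d}_{\nu_n}f(x_n)+z}\big(a+\langle v,h\rangle\big)+\tfrac12\|h\|^2;$$ choose $\alpha_n(z)\in\arg\min\{f(x_n+\alpha h_n(z))\mid\alpha\in[0,\alpha_*]\}$; choose $z_n\in\arg\min\{f(x_n+\alpha_n(z)h_n(z))\mid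 z\in\overline{d}_{\mu_n}f(x_n)\}$; and set $x_{n+1}=x_n+\alpha_n(z_n)h_n(z_n)$. It is assumed that $\alpha_n(z)$ and $z_n$ are well defined at every iteration. *)

(* Defs.v *)
From HB Require Import structures.
From mathcomp Require Export all_boot all_order all_algebra.
From mathcomp Require Export all_classical all_reals all_analysis.
Import Order.TTheory GRing.Theory Num.Theory.
Import numFieldNormedType.Exports.
Local Open Scope classical_set_scope.
Local Open Scope ring_scope.

(* R^d is 'rV[R]_d. The library's norm `|x| on it is the sup norm, so the
   Euclidean norm is defined here; both induce the same topology. *)
Section Euclidean.
Context {R : realType} {d : nat}.
Implicit Types (f : 'rV[R]_d -> R) (x y : 'rV[R]_d).

Definition dot x y : R := \sum_(i < d) x 0 i * y 0 i.

Definition enorm x : R := Num.sqrt (dot x x).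

Definition gradient f x : 'rV[R]_d := \row_(i < d) 'D_(delta_mx 0 i) f x.

(* The library's Jacobian acts on row vectors from the right: the derivative
   of the gradient at x in the direction y is y *m hessian f x. *)
Definition hessian f x : 'M[R]_d := 'J (gradient f) x.

Definition twice_continuously_differentiable f : Prop :=
  [/\ forall x, differentiable f x,
      forall x, differentiable (gradient f) x &
      continuous (hessian f)].

Definition hessian_bounds (m0 M : R) f : Prop :=
  forall x y, m0 * enorm y ^+ 2 <= dot y (y *m hessian f x) <= M * enorm y ^+ 2.

Definition strict_local_min f x : Prop :=
  \forall y \near x^', f x < f y.

End Euclidean.

Definition is_argmin {R : realType} {T : Type} (phi : T -> R) (A : set T)
  (t : T) : Prop := A t /\ forall s, A s -> phi t <= phi s.

(* The sum of an empty family is {0}. *)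
Definition minkowski_sum {V : nmodType} {n : nat} (A : 'I_n -> set V) : set V :=
  [set v | exists2 w : 'I_n -> V, forall k, A k (w k) & v = \sum_(k < n) w k].

Definition convex_hull {R : realType} {V : lmodType R} (A : set V) : set V :=
  smallest (@convex_set R V) A.

(* The k-th maximum ranges over 'I_(p k).+1 and the l-th minimum over
   'I_(q l).+1: these are nonempty index sets, numbered from 0. *)
Section Codifferential.
Context {R : realType} {d m s : nat} {p : 'I_m -> nat} {q : 'I_s -> nat}.
Variable g : forall k : 'I_m, 'I_(p k).+1 -> 'rV[R]_d -> R.
Variable u : forall l : 'I_s, 'I_(q l).+1 -> 'rV[R]_d -> R.

Definition max_part (k : 'I_m) (x : 'rV[R]_d) : R :=
  \big[Num.max/g k ord0 x]_(i < (p k).+1) g k i x.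

Definition min_part (l : 'I_s) (x : 'rV[R]_d) : R :=
  \big[Num.min/u l ord0 x]_(j < (q l).+1) u l j x.

Definition objective (x : 'rV[R]_d) : R :=
  \sum_(k < m) max_part k x + \sum_(l < s) min_part l x.

Definition max_indices (nu : \bar R) (k : 'I_m) (x : 'rV[R]_d) :
    set 'I_(p k).+1 :=
  [set i | ((max_part k x)%:E - nu <= (g k i x)%:E)%E].

Definition min_indices (mu : \bar R) (l : 'I_s) (x : 'rV[R]_d) :
    set 'I_(q l).+1 :=
  [set j | ((u l j x)%:E <= (min_part l x)%:E + mu)%E].

Definition hypodiff (nu : \bar R) (x : 'rV[R]_d) : set (R^o * 'rV[R]_d) :=
  minkowski_sum (fun k : 'I_m =>
    [set (g k i x - max_part k x, gradient (g k i) x) | i in max_indices nu k x]).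

Definition hyperdiff (mu : \bar R) (x : 'rV[R]_d) : set (R^o * 'rV[R]_d) :=
  minkowski_sum (fun l : 'I_s =>
    [set (u l j x - min_part l x, gradient (u l j) x) | j in min_indices mu l x]).

(* The supremum is a maximum, as the convex hull of a nonempty finite set is
   nonempty and compact. *)
Definition model (nu : \bar R) (x : 'rV[R]_d) (z : R^o * 'rV[R]_d)
    (h : 'rV[R]_d) : R :=
  sup [set av.1 + dot av.2 h | av in [set w + z | w in convex_hull (hypodiff nu x)]]
  + 2^-1 * enorm h ^+ 2.

(* x is a sequence generated by the method. The minimizer h n z is unique by
   strong convexity of the model. For astar = +oo the step sizes range over
   [0, +oo[. *)
Definition QR_MCD (nu mu : nat -> \bar R) (astar : \bar R)
    (x : nat -> 'rV[R]_d) : Prop :=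
  [/\ forall n, (0 <= nu n)%E, forall n, (0 <= mu n)%E, (0 < astar)%E &
   exists (h : nat -> R^o * 'rV[R]_d -> 'rV[R]_d)
          (alpha : nat -> R^o * 'rV[R]_d -> R)
          (z : nat -> R^o * 'rV[R]_d),
   forall n,
   [/\ forall w, hyperdiff (mu n) (x n) w ->
         is_argmin (model (nu n) (x n) w) setT (h n w),
       forall w, hyperdiff (mu n) (x n) w ->
         is_argmin (fun a => objective (x n + a *: h n w))
           [set a | 0 <= a /\ (a%:E <= astar)%E] (alpha n w),
       is_argmin (fun w => objective (x n + alpha n w *: h n w))
         (hyperdiff (mu n) (x n)) (z n) &
       x n.+1 = x n + alpha n (z n) *: h n (z n)]].

End Codifferential.

(* Main.v *)
Require Import Defs.
From mathcomp Require Import ring lra.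
Import Order.TTheory GRing.Theory Num.Theory.
Import numFieldNormedType.Exports.
Local Open Scope classical_set_scope.
Local Open Scope ring_scope.

(** Write [N] for the number [m + s] of terms. For each choice [j] of one
    function [u l (j l)] in every minimum, the branch
    [branch g u j = sum of the maxima + sum of the u l (j l)] is a sum of
    maxima of functions whose Hessians lie between [m0] and [M]; the objective
    [f] is the minimum of these finitely many branches, and the branches that
    attain it at a point are called active there.

    One iteration. Linearizing every function of a branch at [x] gives a convex
    piecewise affine function [linearized g u x j], which differs from
    [h |-> branch g u j (x + h)] by an amount between [N m0 / 2 |h|^2] and
    [N M / 2 |h|^2] ([branch_ge_linearized], [branch_le_linearized]). With
    [nu = +oo], the model minimized by the method is, up to a constant, this
    linearization plus [|h|^2 / 2] ([model_linearized]). Let [h] be its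
    minimizer. Moving only a fraction [t <= 1 / (N M)] along [h] keeps the branch
    below the combination of its value at [x] and the model at [h] with weights
    [1 - t] and [t]; comparing [h] with [r (y - x)], [r <= N m0], bounds the model
    at [h] by the combination of the values of the branch at [x] and [y] with
    weights [1 - r] and [r]. Altogether ([damped_step_le])
    [f (x + t h) <= (1 - t r) branch j x + t r branch j y] for all [y]. Since
    [t <= 1 <= astar], the line search does at least as well, and since the
    iterate is the best over all candidates, the bound holds for every branch
    that is nearly active at the iterate ([QR_MCD_step]).

    The limit. As [mu] has a positive limit, every branch active at the limit
    [xstar] is a candidate at all late iterates. Passing to the limit in the
    bound gives [f xstar <= branch j y] for all [y]: the point [xstar] minimizes
    every branch active there. By strong convexity these branches grow
    quadratically around [xstar] ([min_branch_growth]), and near [xstar] no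
    other branch is active ([near_active]), so [f] grows quadratically too and
    the local minimum is strict.

    The rate. A branch active at a late iterate is active at [xstar] as well, so
    the bound with [y = xstar] reads
    [f (x n.+1) - f xstar <= (1 - t r) (f (x n) - f xstar)], and quadratic growth
    turns this decay of the values into the decay of the distances
    ([linear_rate]). *)

(** * Euclidean inner product *)

Section InnerProduct.
Context {R : realType} {d : nat}.
Implicit Types (x y z : 'rV[R]_d).

Lemma dotC x y : dot x y = dot y x.
Proof. by apply: eq_bigr => i _; rewrite mulrC. Qed.

Lemma dotDl x y z : dot (x + y) z = dot x z + dot y z.
Proof. by rewrite -big_split/=; apply: eq_bigr => i _; rewrite mxE mulrDl. Qed.

Lemma dotZl a x y : dot (a *: x) y = a * dot x y.
Proof. by rewrite mulr_sumr; apply: eq_bigr => i _; rewrite mxE mulrA. Qed.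

Lemma dotZr a x y : dot x (a *: y) = a * dot x y.
Proof. by rewrite dotC dotZl dotC. Qed.

Lemma dot0l x : dot 0 x = 0.
Proof. by rewrite /dot big1// => i _; rewrite mxE mul0r. Qed.

Lemma dot_suml n (F : 'I_n -> 'rV[R]_d) x :
  dot (\sum_(i < n) F i) x = \sum_(i < n) dot (F i) x.
Proof.
apply: (big_morph (fun y => dot y x)) => [y z|]; first exact: dotDl.
exact: dot0l.
Qed.

Lemma dot_ge0 x : 0 <= dot x x.
Proof. by apply: sumr_ge0 => i _; rewrite -expr2 sqr_ge0. Qed.

Lemma sqr_enorm x : enorm x ^+ 2 = dot x x.
Proof. by rewrite sqr_sqrtr// dot_ge0. Qed.

Lemma sqr_enormZ a x : enorm (a *: x) ^+ 2 = a ^+ 2 * enorm x ^+ 2.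
Proof. by rewrite !sqr_enorm dotZl dotZr mulrA expr2. Qed.

Lemma sqr_enorm_gt0 x : x != 0 -> 0 < enorm x ^+ 2.
Proof.
move=> x0; rewrite sqr_enorm lt_neqAle dot_ge0 andbT eq_sym.
apply: contra x0; rewrite psumr_eq0 => [/allP x0|i _]; last first.
  by rewrite -expr2 sqr_ge0.
apply/eqP/rowP => i; rewrite mxE; apply/eqP.
by have := x0 i; rewrite mem_index_enum mulf_eq0 orbb; apply.
Qed.

End InnerProduct.

(** * Second-order Taylor bounds *)

Section Taylor.
Local Set Implicit Arguments.
Local Unset Strict Implicit.
Context {R : realType}.

(** The mean value theorem is applied first to [f'], giving
    [f' c >= f' 0 + a c], and then to [f t - a t^2 / 2]. *)
Lemma taylor2_ge (f f' f'' : R -> R) (a : R) :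
  (forall t : R, is_derive t 1 f (f' t)) ->
  (forall t : R, is_derive t 1 f' (f'' t)) ->
  (forall t, a <= f'' t) ->
  f 0 + f' 0 + a / 2 <= f 1.
Proof.
move=> df df' le_a.
pose k t := f t - a / 2 * t ^+ 2.
have dk (t : R) : is_derive t 1 k (f' t - a * t).
  have := df t => dft.
  apply: is_derive_eq; rewrite /GRing.scale/=; lra.
have [c /[!in_itv]/= /andP[c0 c1] kc] : exists2 c : R, c \in `[0, 1] &
    k 1 - k 0 = (f' c - a * c) * (1 - 0).
  apply: (MVT_segment ler01).
  by apply: derivable_within_continuous => t _; have [] := dk t.
have [c' _ f'c] : exists2 c' : R, c' \in `[0, c] & f' c - f' 0 = f'' c' * (c - 0).
  apply: (MVT_segment c0).
  by apply: derivable_within_continuous => t _; have [] := df' t.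
have : a * c <= f' c - f' 0 by rewrite f'c subr0 ler_wpM2r.
move: kc; rewrite /k expr1n expr0n/=; lra.
Qed.

Lemma taylor2_le (f f' f'' : R -> R) (a : R) :
  (forall t : R, is_derive t 1 f (f' t)) ->
  (forall t : R, is_derive t 1 f' (f'' t)) ->
  (forall t, f'' t <= a) ->
  f 1 <= f 0 + f' 0 + a / 2.
Proof.
move=> df df' le_a.
have le_Na t : - a <= - f'' t by rewrite lerN2.
have : - f 0 + - f' 0 + - a / 2 <= - f 1.
  exact: taylor2_ge (fun t => is_deriveN (df t)) (fun t => is_deriveN (df' t)) le_Na.
lra.
Qed.

Context {d : nat}.

(** The difference quotients of the two derivatives are the same functions. *)
Lemma is_derive_line (W : normedModType R) (f : 'rV[R]_d -> W) (x h : 'rV[R]_d)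
    (t : R) (df : W) :
  is_derive (x + t *: h) h f df ->
  is_derive t 1 (fun s : R => f (x + s *: h)) df.
Proof.
have E : (fun s : R => s^-1 *: (((fun s : R => f (x + s *: h)) \o shift t) (s *: 1)
     - f (x + t *: h)))
   = (fun s => s^-1 *: ((f \o shift (x + t *: h)) (s *: h) - f (x + t *: h))).
  apply/funext => s /=; congr (_ *: (f _ - _)).
  by rewrite scalerDl /GRing.scale/= mulr1 addrCA.
by case=> dfx Dfx; split; rewrite /derivable /derive E.
Qed.

Lemma is_derive_gradient (f : 'rV[R]_d -> R) (x h : 'rV[R]_d) :
  differentiable f x -> is_derive x h f (dot (gradient f x) h).
Proof.
move=> df; apply: DeriveDef; first exact: diff_derivable.
rewrite deriveE// {1}(row_sum_delta h) linear_sum; apply: eq_bigr => i _.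
by rewrite linearZ/= -deriveE// mxE mulrC.
Qed.

Lemma is_derive_hessian (f : 'rV[R]_d -> R) (x h : 'rV[R]_d) :
  differentiable (gradient f) x ->
  is_derive x h (fun y => dot (gradient f y) h) (dot h (h *m hessian f x)).
Proof.
move=> df.
have dh : derivable (gradient f) x h by exact: diff_derivable.
have di i : is_derive x h (fun y => gradient f y 0 i) ((h *m hessian f x) 0 i).
  apply: DeriveDef; first exact: (derivable_mxP _ _ _).1.
  by rewrite -deriveEjacobian// derive_mx// mxE.
have -> : (fun y => dot (gradient f y) h) =
    \sum_(i < d) (fun y => h 0 i *: gradient f y 0 i).
  by apply/funext => y; rewrite fct_sumE; apply: eq_bigr => i _; rewrite mulrC.
exact: is_derive_sum (fun i => is_deriveZ (h 0 i) (di i)).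
Qed.

(** The restriction of [f] to the line through [x] in the direction [h] has second
    derivative [dot h (h *m hessian f (x + t *: h))]. *)
Lemma hessian_bounds_taylor (m0 M : R) (f : 'rV[R]_d -> R) (x h : 'rV[R]_d) :
  twice_continuously_differentiable f -> hessian_bounds m0 M f ->
  f x + dot (gradient f x) h + m0 / 2 * enorm h ^+ 2 <= f (x + h)
    <= f x + dot (gradient f x) h + M / 2 * enorm h ^+ 2.
Proof.
move=> [df dg _] bf.
have d1 (t : R) := is_derive_line (is_derive_gradient h (df (x + t *: h))).
have d2 (t : R) := is_derive_line (is_derive_hessian h (dg (x + t *: h))).
have lo := taylor2_ge d1 d2 (fun t => proj1 (andP (bf (x + t *: h) h))).
have hi := taylor2_le d1 d2 (fun t => proj2 (andP (bf (x + t *: h) h))).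
by move: lo hi; rewrite scale0r scale1r addr0 !(mulrAC _ _ 2^-1) => -> ->.
Qed.

End Taylor.

(** * Finite extrema and suprema *)

Section Extrema.
Context {R : realType} {n : nat}.
Implicit Types (F : 'I_n.+1 -> R) (c : R).

Lemma bigmax_attained F :
  exists i, \big[Num.max/F ord0]_(i < n.+1) F i = F i.
Proof.
apply: (big_ind (fun a => exists i, a = F i)) => [|a b [i ->] [j ->]|i _].
- by exists ord0.
- by have [ab|ba] := leP (F i) (F j); [exists j|exists i].
- by exists i.
Qed.

Lemma bigmin_attained F :
  exists i, \big[Num.min/F ord0]_(i < n.+1) F i = F i.
Proof.
apply: (big_ind (fun a => exists i, a = F i)) => [|a b [i ->] [j ->]|i _].
- by exists ord0.
- by have [ab|ba] := leP (F i) (F j); [exists i|exists j].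
- by exists i.
Qed.

End Extrema.

Lemma sup_attained {R : realType} (A : set R) (a : R) :
  A a -> ubound A a -> sup A = a.
Proof.
move=> Aa ubA; apply/le_anti/andP; split; last by apply: ub_le_sup; first exists a.
by apply: ge_sup; first exists a.
Qed.

(** * Branches of the objective and their linearizations *)

Section Branch.
Local Set Implicit Arguments.
Local Unset Strict Implicit.
Context {R : realType} {d m s : nat} {p : 'I_m -> nat} {q : 'I_s -> nat}.
Implicit Types g : forall k : 'I_m, 'I_(p k).+1 -> 'rV[R]_d -> R.
Implicit Types u : forall l : 'I_s, 'I_(q l).+1 -> 'rV[R]_d -> R.
Implicit Types (j : forall l : 'I_s, 'I_(q l).+1) (x y h : 'rV[R]_d).

(** A strongly convex function obtained by fixing the choice [j] made by the
    minima; the objective is the pointwise minimum of the branches. *)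
Definition branch g u j y : R :=
  \sum_(k < m) max_part g k y + \sum_(l < s) u l (j l) y.

Definition active u j y := forall l, u l (j l) y = min_part u l y.

(** A uniform bound between two families of functions passes to maxima and
    costs one [c] per term. Both families may be evaluated at different points,
    so that a function can be compared with its tangent. *)
Lemma branch_le g g' u u' j y y' (c : R) :
  (forall k i, g k i y <= g' k i y' + c) ->
  (forall l i, u l i y <= u' l i y' + c) ->
  branch g u j y <= branch g' u' j y' + (m + s)%:R * c.
Proof.
move=> gle ule.
have sumc n (F : 'I_n -> R) : \sum_i (F i + c) = \sum_i F i + n%:R * c.
  by rewrite big_split/= sumr_const card_ord mulr_natl.
rewrite /branch natrD mulrDl addrACA -!sumc lerD//; apply: ler_sum => k _ //.
have [i] := bigmax_attained (fun i => g k i y).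
rewrite {1}/max_part => ->.
by apply: le_trans (gle k i) _; rewrite lerD2r; exact: le_bigmax.
Qed.

Lemma objective_le_branch g u j y : objective g u y <= branch g u j y.
Proof. by rewrite lerD2l; apply: ler_sum => l _; exact: bigmin_le. Qed.

Lemma active_branch g u j y : active u j y -> branch g u j y = objective g u y.
Proof. by move=> jy; congr (_ + _); apply: eq_bigr => l _; rewrite jy. Qed.

Lemma active_exists u y : exists j, active u j y.
Proof.
apply: (@fin_all_exists _ _ (fun l i => u l i y = min_part u l y)) => l.
by have [i] := bigmin_attained (fun i => u l i y); exists i.
Qed.

Definition tangent (f : 'rV[R]_d -> R) x h : R := f x + dot (gradient f x) h.

Definition linearized g u x j h : R :=
  branch (fun k i => tangent (g k i) x) (fun l i => tangent (u l i) x) j h.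

(** Convexity along a segment issued from [0]: maxima of affine functions are
    convex, and tangents agree with the functions at [0]. *)
Lemma linearized_segment g u x j h (t : R) : 0 <= t <= 1 ->
  linearized g u x j (t *: h) <= (1 - t) * branch g u j x + t * linearized g u x j h.
Proof.
move=> /andP[t0 t1].
have tanE f : tangent f x (t *: h) = (1 - t) * f x + t * tangent f x h.
  by rewrite /tangent dotZr; ring.
rewrite /linearized /branch !mulrDr addrACA !mulr_sumr -!big_split/=.
apply: lerD; apply: ler_sum => k _; last by rewrite tanE.
have [i] := bigmax_attained (fun i => tangent (g k i) x (t *: h)).
rewrite {1}/max_part => ->.
by rewrite tanE lerD// ler_wpM2l// ?subr_ge0//; exact: le_bigmax.
Qed.

(** The element of the hyperdifferential that the choice [j] selects. It is a
    candidate of the method as soon as every [j l] is a [mu]-minimal index. *)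
Definition hyperdiff_elt u x j : R^o * 'rV[R]_d :=
  \sum_(l < s) (u l (j l) x - min_part u l x, gradient (u l (j l)) x).

Lemma sumr_pair (V W : zmodType) n (F : 'I_n -> V) (G : 'I_n -> W) :
  \sum_(i < n) (F i, G i) = (\sum_i F i, \sum_i G i).
Proof. by elim/big_rec3: _ => // i a b c _ ->. Qed.

(** An affine function has the same upper bounds on a set and on its convex hull,
    so the supremum is a maximum over the Minkowski sum itself; a maximum of sums
    over independent choices is the sum of the maxima. As [nu = +oo], all the
    [g k i] take part. *)
Lemma model_linearized g u x j h :
  model g +oo%E x (hyperdiff_elt u x j) h =
    linearized g u x j h - objective g u x + 2^-1 * enorm h ^+ 2.
Proof.
pose T k i := tangent (g k i) x.
pose top := \sum_(k < m) max_part T k h - \sum_(k < m) max_part g k x.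
have valE (i : forall k, 'I_(p k).+1) :
    let w := \sum_(k < m) ((g k (i k) x - max_part g k x, gradient (g k (i k)) x)
      : R^o * 'rV[R]_d) in
    w.1 + dot w.2 h = \sum_(k < m) T k (i k) h - \sum_(k < m) max_part g k x.
  rewrite /= (sumr_pair (V := R^o))/= dot_suml -sumrB -big_split/=.
  by apply: eq_bigr => k _; rewrite /T /tangent; ring.
have hull_le : convex_hull (hypodiff g +oo%E x) `<=`
    [set w | w.1 + dot w.2 h <= top].
  apply: smallest_sub.
    move=> v w t; rewrite !inE/= => vle wle.
    rewrite dotDl !dotZl /= addrACA -!mulrDr.
    have t0 : 0 <= t%:num by [].
    have t1 : t%:num <= 1 by [].
    have tvle := ler_wpM2l t0 vle.
    have twle : (1 - t%:num) * (w.1 + dot w.2 h) <= (1 - t%:num) * top.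
      by rewrite ler_wpM2l// subr_ge0.
    by rewrite /unstable.onem; lra.
  move=> _ [f fP ->].
  have [i iP] : exists i : forall k, 'I_(p k).+1, forall k,
      f k = (g k (i k) x - max_part g k x, gradient (g k (i k)) x).
    apply: (@fin_all_exists _ _ (fun k a =>
      f k = (g k a x - max_part g k x, gradient (g k a) x))) => k.
    by have [a _ <-] := fP k; exists a.
  rewrite (eq_bigr _ (fun k _ => iP k)) /= valE lerD2r.
  by apply: ler_sum => k _; exact: le_bigmax.
have hull_top :
    exists2 w, convex_hull (hypodiff g +oo%E x) w & w.1 + dot w.2 h = top.
  have [i iP] : exists i : forall k, 'I_(p k).+1,
      forall k, max_part T k h = T k (i k) h.
    apply: (@fin_all_exists _ _ (fun k a => max_part T k h = T k a h)) => k.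
    exact: bigmax_attained.
  exists (\sum_(k < m) (g k (i k) x - max_part g k x, gradient (g k (i k)) x)).
    apply: (@sub_smallest _ _ _ (hypodiff g +oo%E x)) => //.
    exists (fun k => (g k (i k) x - max_part g k x, gradient (g k (i k)) x)) => //.
    by move=> k; exists (i k) => //; rewrite /max_indices/= leNye.
  by rewrite valE /top; congr (_ - _); apply: eq_bigr => k _; rewrite iP.
set z := hyperdiff_elt u x j; congr (_ + _).
have -> : linearized g u x j h - objective g u x = top + (z.1 + dot z.2 h).
  rewrite /z /hyperdiff_elt (sumr_pair (V := R^o))/= dot_suml.
  rewrite /top /linearized /branch /objective.
  have -> : \sum_(l < s) tangent (u l (j l)) x h =
    \sum_(l < s) u l (j l) x + \sum_(l < s) dot (gradient (u l (j l)) x) h.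
    by rewrite -big_split.
  rewrite sumrB; ring.
have addE w : (w + z).1 + dot (w + z).2 h = w.1 + dot w.2 h + (z.1 + dot z.2 h).
  by rewrite dotDl/= addrACA.
apply: sup_attained => [|_ [_ [w hw <-] <-]].
  have [w hw <-] := hull_top; rewrite -addE.
  by exists (w + z) => //; exists w.
by rewrite addE lerD2r hull_le.
Qed.

End Branch.

(** * Continuity of finite maxima, minima and sums *)

Section Continuity.
Local Set Implicit Arguments.
Local Unset Strict Implicit.
Context {R : realType} {T : topologicalType}.

(** The default value of the maximum depends on the point as well, as it does
    in [max_part]. *)
Lemma continuous_bigmax (I : Type) (r : seq I) (a : T -> R) (F : I -> T -> R) :
  continuous a -> (forall i, continuous (F i)) ->
  continuous (fun x => \big[Num.max/a x]_(i <- r) F i x).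
Proof.
move=> ca cF; elim: r => [|i r IHr] x.
  under eq_fun do rewrite big_nil; exact: ca.
under eq_fun do rewrite big_cons; exact: (continuous_max (cF i x) (IHr x)).
Qed.

Lemma continuous_bigmin (I : Type) (r : seq I) (a : T -> R) (F : I -> T -> R) :
  continuous a -> (forall i, continuous (F i)) ->
  continuous (fun x => \big[Num.min/a x]_(i <- r) F i x).
Proof.
move=> ca cF; elim: r => [|i r IHr] x.
  under eq_fun do rewrite big_nil; exact: ca.
under eq_fun do rewrite big_cons; exact: (continuous_min (cF i x) (IHr x)).
Qed.

Lemma continuous_sum n (F : 'I_n -> T -> R) :
  (forall i, continuous (F i)) -> continuous (fun x => \sum_(i < n) F i x).
Proof. by move=> cF; apply: continuous_big => //; exact: add_continuous. Qed.

End Continuity.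

Lemma continuous_C2 {R : realType} {d : nat} (f : 'rV[R]_d -> R) :
  twice_continuously_differentiable f -> continuous f.
Proof. by move=> [df _ _] x; exact/differentiable_continuous. Qed.

(** * Descent estimates *)

Section Descent.
Context {R : realType} {d m s : nat} {p : 'I_m -> nat} {q : 'I_s -> nat}.
Variable g : forall k : 'I_m, 'I_(p k).+1 -> 'rV[R]_d -> R.
Variable u : forall l : 'I_s, 'I_(q l).+1 -> 'rV[R]_d -> R.
Variables (m0 M : R).
Hypothesis g_C2 : forall k i, twice_continuously_differentiable (g k i).
Hypothesis u_C2 : forall l i, twice_continuously_differentiable (u l i).
Hypothesis g_hess : forall k i, hessian_bounds m0 M (g k i).
Hypothesis u_hess : forall l i, hessian_bounds m0 M (u l i).
Hypothesis m0_gt0 : 0 < m0.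
Hypothesis m0_lt_M : m0 < M.
Local Set Implicit Arguments.
Local Unset Strict Implicit.
Implicit Types (j : forall l : 'I_s, 'I_(q l).+1) (x y h : 'rV[R]_d).

Let N : R := (m + s)%:R.

Let M_gt0 : 0 < M. Proof. exact: lt_trans m0_lt_M. Qed.

Lemma branch_ge_linearized x j h :
  linearized g u x j h + N * m0 / 2 * enorm h ^+ 2 <= branch g u j (x + h).
Proof.
have H (f : 'rV[R]_d -> R) : twice_continuously_differentiable f ->
    hessian_bounds m0 M f ->
    tangent f x h <= f (x + h) + - (m0 / 2 * enorm h ^+ 2).
  by move=> fC fb; have /andP[+ _] := hessian_bounds_taylor x h fC fb; rewrite lerBrDr.
have := branch_le (g := fun k i => tangent (g k i) x)
  (u := fun l i => tangent (u l i) x) (g' := g) (u' := u) (y := h) (y' := x + h) j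
  (fun k i => H _ (g_C2 k i) (g_hess k i)) (fun l i => H _ (u_C2 l i) (u_hess l i)).
rewrite -/N /linearized; lra.
Qed.

Lemma branch_le_linearized x j h :
  branch g u j (x + h) <= linearized g u x j h + N * M / 2 * enorm h ^+ 2.
Proof.
have H (f : 'rV[R]_d -> R) : twice_continuously_differentiable f ->
    hessian_bounds m0 M f ->
    f (x + h) <= tangent f x h + M / 2 * enorm h ^+ 2.
  by move=> fC fb; have /andP[_] := hessian_bounds_taylor x h fC fb.
have := branch_le (g := g) (u := u)
  (g' := fun k i => tangent (g k i) x) (u' := fun l i => tangent (u l i) x)
  (y := x + h) (y' := h) j
  (fun k i => H _ (g_C2 k i) (g_hess k i)) (fun l i => H _ (u_C2 l i) (u_hess l i)).
by rewrite -/N !mulrA.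
Qed.

(** Three facts combine. Along [h] the linearization is convex, and for
    [t N M <= 1] the quadratic error at [t *: h] is at most [t |h|^2 / 2], so the
    branch at [x + t *: h] is at most [1 - t] times its value at [x] plus [t]
    times [linearized g u x j h + |h|^2 / 2]. The latter is the model up to a
    constant, so its value at [h] is at most that at [r *: (y - x)]. Finally, for
    [r <= N m0] the term [r^2 |y - x|^2 / 2] is absorbed by the strong convexity
    of the branch. *)
Lemma damped_step_le x j h y (t r : R) :
  is_argmin (model g +oo%E x (hyperdiff_elt u x j)) setT h ->
  0 <= t <= 1 -> t * (N * M) <= 1 -> 0 <= r <= 1 -> r <= N * m0 ->
  objective g u (x + t *: h) <=
    (1 - t * r) * branch g u j x + t * r * branch g u j y.
Proof.
move=> [_ hmin] t01 tNM r01 rNm; have /andP[t0 t1] := t01; have /andP[r0 r1] := r01.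
have := hmin (r *: (y - x)) I; rewrite !model_linearized sqr_enormZ => min_le.
have sm_le := linearized_segment g u x j (y - x) r01.
have lo := branch_ge_linearized x j (y - x); rewrite subrKC in lo.
have up := branch_le_linearized x j (t *: h); rewrite sqr_enormZ in up.
have st_le := linearized_segment g u x j h t01.
apply: (le_trans (objective_le_branch g u j _)).
set H := enorm h ^+ 2 in min_le up; set D := enorm (y - x) ^+ 2 in min_le lo.
have H0 : 0 <= H by exact: sqr_ge0.
have D0 : 0 <= D by exact: sqr_ge0.
set L := linearized g u x j in min_le sm_le lo up st_le.
set B := branch g u j in up lo st_le sm_le *.
have tH : t * (t * (N * M)) * H <= t * H by rewrite ler_wpM2r// ler_piMr.
have rD : r * r * D <= r * (N * m0) * D by rewrite ler_wpM2r// ler_wpM2l.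
have rlo := ler_wpM2l r0 lo.
have : L h + H / 2 <= (1 - r) * B x + r * B y by lra.
move=> /(ler_wpM2l t0); lra.
Qed.

Let cg k i : continuous (g k i). Proof. exact: continuous_C2. Qed.

Let cu l i : continuous (u l i). Proof. exact: continuous_C2. Qed.

Let cmin l : continuous (min_part u l).
Proof. exact: continuous_bigmin. Qed.

Let csum_max : continuous (fun x => \sum_(k < m) max_part g k x).
Proof. by apply: continuous_sum => k; exact: continuous_bigmax. Qed.

Lemma continuous_branch j : continuous (branch g u j).
Proof.
move=> x; apply: (@continuousD _ R^o); first exact: csum_max.
by apply: continuous_sum => l; exact: cu.
Qed.

Lemma continuous_objective : continuous (objective g u).
Proof.
move=> x; apply: (@continuousD _ R^o); first exact: csum_max.
by apply: continuous_sum => l; exact: cmin.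
Qed.

(** A function [u l i] that is not minimal at [x] exceeds the minimum there, hence
    also at all nearby points; there are finitely many pairs [(l, i)]. *)
Lemma near_active x : \forall y \near x, forall j, active u j y -> active u j x.
Proof.
have : \forall y \near x, forall l i,
    u l i y = min_part u l y -> u l i x = min_part u l x.
  apply: (@filter_forall _ _ (fun l y => forall i,
    u l i y = min_part u l y -> u l i x = min_part u l x) (nbhs x) _) => l.
  apply: (@filter_forall _ _ (fun i y =>
    u l i y = min_part u l y -> u l i x = min_part u l x) (nbhs x) _) => i.
  have [ux|ux] := eqVneq (u l i x) (min_part u l x); first exact: nearW.
  have cd : {for x, continuous (fun y => u l i y - min_part u l y)}.
    by apply: (@continuousB _ R^o); [exact: cu|exact: cmin].
  have : u l i x - min_part u l x != 0 by rewrite subr_eq0.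
  move=> /(cvgr_neq0 _ cd); apply: filterS => y /[swap] ->.
  by rewrite subrr eqxx.
apply: filterS => y uy j jy l; exact/uy/jy.
Qed.

(** At a minimizer [x] of the branch, the linearization at [x] in the direction
    [h = y - x] is bounded below by testing minimality at [x + t h], which loses
    [N M / 2 t |h|^2]; strong convexity gains [N m0 / 2 |h|^2]. *)
Lemma min_branch_growth x j : active u j x ->
  (forall y, objective g u x <= branch g u j y) ->
  forall y, objective g u x + N * m0 / 4 * enorm (y - x) ^+ 2 <= branch g u j y.
Proof.
move=> jx xmin y; set h := y - x.
have lo := branch_ge_linearized x j h; rewrite subrKC in lo.
(* This step loses exactly half of the gain, which explains the constant. *)
pose t := m0 / (2 * M).
have t0 : 0 < t by rewrite divr_gt0// mulr_gt0.
have t1 : t <= 1.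
  by rewrite ler_pdivrMr ?mulr_gt0// mul1r; move: (ltW m0_lt_M) M_gt0; lra.
have up := branch_le_linearized x j (t *: h); rewrite sqr_enormZ in up.
have tl := linearized_segment g u x j h (introT andP (conj (ltW t0) t1)).
have := xmin (x + t *: h).
rewrite (active_branch g jx) in tl.
have tM : t * M = m0 / 2 by rewrite /t; field; exact: lt0r_neq0.
have E : N * M / 2 * (t ^+ 2 * enorm h ^+ 2) = t * (N * m0 / 4 * enorm h ^+ 2).
  transitivity (N * (t * M) / 2 * t * enorm h ^+ 2); first by ring.
  by rewrite tM; field.
move=> le_b.
have : t * (objective g u x - linearized g u x j h) <=
    t * (N * m0 / 4 * enorm h ^+ 2) by rewrite -E; lra.
rewrite ler_pM2l//; lra.
Qed.

(** The fixed step [t] is available to the line search and [j] to the choice of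
    the candidate, and the iterate is at least as good. *)
Lemma QR_MCD_step (mu : nat -> \bar R) (astar : \bar R) (x : nat -> 'rV[R]_d)
    (n : nat) j y (t r : R) :
  (1 <= astar)%E -> QR_MCD g u (fun=> +oo%E) mu astar x ->
  (forall l, min_indices u (mu n) l (x n) (j l)) ->
  0 <= t <= 1 -> t * (N * M) <= 1 -> 0 <= r <= 1 -> r <= N * m0 ->
  objective g u (x n.+1) <=
    (1 - t * r) * branch g u j (x n) + t * r * branch g u j y.
Proof.
move=> astar1 [_ _ _ [h [alpha [z step]]]] jn t01 tNM r01 rNm.
have [hmin amin [zn zmin] ->] := step n.
have zj : hyperdiff u (mu n) (x n) (hyperdiff_elt u (x n) j).
  exists (fun l => (u l (j l) (x n) - min_part u l (x n),
                    gradient (u l (j l)) (x n))) => // l.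
  by exists (j l).
have [_ aj] := amin _ zj.
apply: le_trans (zmin _ zj) _; apply: le_trans (aj t _) _.
  have /andP[t0 t1] := t01; split => //=.
  by apply: le_trans astar1; rewrite lee_fin.
exact: damped_step_le (hmin _ zj) t01 tNM r01 rNm.
Qed.

(** The excess of [u l i] over the minimum tends to [0] when [i] is minimal at the
    limit, while [mu] stays above a positive constant. *)
Lemma near_min_indices (mu : nat -> \bar R) (mu_lim : \bar R)
    (x : nat -> 'rV[R]_d) (xstar : 'rV[R]_d) :
  mu @ \oo --> mu_lim -> (0 < mu_lim)%E -> x @ \oo --> xstar ->
  \forall n \near \oo, forall j, active u j xstar ->
    forall l, min_indices u (mu n) l (x n) (j l).
Proof.
move=> mu_cvg mu_lim0 x_cvg.
have [e e0 e_lt] : exists2 e : R, 0 < e & (e%:E < mu_lim)%E.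
  case: mu_lim mu_lim0 {mu_cvg} => [r| |//]; last by exists 1; rewrite ?ltry.
  rewrite lte_fin => r0; exists (r / 2); first by rewrite divr_gt0.
  by rewrite lte_fin; lra.
have mu_gt : \forall n \near \oo, (e%:E < mu n)%E := mu_cvg _ (open_ereal_gt' e_lt).
have u_lt : \forall n \near \oo, forall l i, u l i xstar = min_part u l xstar ->
    u l i (x n) - min_part u l (x n) < e.
  apply: (@filter_forall _ _ (fun l n => forall i,
    u l i xstar = min_part u l xstar ->
    u l i (x n) - min_part u l (x n) < e) \oo _) => l.
  apply: (@filter_forall _ _ (fun i n =>
    u l i xstar = min_part u l xstar ->
    u l i (x n) - min_part u l (x n) < e) \oo _) => i.
  have [ui|/eqP ui] := eqVneq (u l i xstar) (min_part u l xstar); last exact: nearW.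
  have cd : {for xstar, continuous (fun y => u l i y - min_part u l y)}.
    apply: (@continuousB _ R^o); first exact: continuous_C2.
    by apply: continuous_bigmin => *; exact: continuous_C2.
  have := cvg_comp _ _ x_cvg cd.
  rewrite ui subrr => /cvgr_lt /(_ _ e0); apply: filterS => n + _; exact.
near=> n.
have mu_n : (e%:E < mu n)%E by near: n.
have u_n : forall l i, u l i xstar = min_part u l xstar ->
    u l i (x n) - min_part u l (x n) < e by near: n.
move=> j jx l; rewrite /min_indices/=; have := u_n _ _ (jx l).
rewrite ltrBlDl => u_le.
apply: (@le_trans _ _ (min_part u l (x n) + e)%:E); first by rewrite lee_fin ltW.
by rewrite EFinD leeD2l// ltW.
Unshelve. all: by end_near. Qed.

End Descent.

(** * Linear convergence from quadratic growth *)

Section Rate.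
Local Set Implicit Arguments.
Local Unset Strict Implicit.
Context {R : realType}.

(** The shifts by [1] in [1 / (1 + b)] and [a / (1 + a)] keep both at most [1]
    whatever the sizes of [a] and [b]. *)
Lemma step_sizes_exist (a b : R) : 0 < a -> 0 < b ->
  exists t r : R, [/\ 0 < t <= 1, t * b <= 1, 0 < r < 1 & r <= a].
Proof.
move=> a0 b0; have a1 : 0 < 1 + a by lra.
have b1 : 0 < 1 + b by lra.
exists (1 + b)^-1, (a / (1 + a)); split.
- by rewrite invr_gt0 b1 invf_le1//; lra.
- by rewrite mulrC ler_pdivrMr//; lra.
- by rewrite divr_gt0// ltr_pdivrMr//; lra.
- by rewrite ler_pdivrMr// mulrDr mulr1 lerDl mulr_ge0// ltW.
Qed.

Lemma geometric_decay (a : nat -> R) (c : R) (n0 n : nat) : 0 <= c ->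
  (forall n, (n0 <= n)%N -> a n.+1 <= c * a n) -> (n0 <= n)%N ->
  a n <= c ^+ (n - n0) * a n0.
Proof.
move=> c0 ac; elim: n => [|n IHn].
  by rewrite leqn0 => /eqP ->; rewrite subnn mul1r.
rewrite leq_eqVlt => /predU1P[<-|n0n]; first by rewrite subnn mul1r.
apply: (le_trans (ac _ n0n)); rewrite subSn// exprS -mulrA.
by rewrite ler_wpM2l//; exact: IHn.
Qed.

(** The square of the distance decays at least as fast as [a], which explains the
    square root [c `^ (n / 2)]. *)
Lemma linear_rate {d : nat} (a : nat -> R) (v : nat -> 'rV[R]_d) (c k : R)
    (n0 : nat) : 0 < c < 1 -> 0 < k ->
  (forall n, (n0 <= n)%N -> a n.+1 <= c * a n) ->
  (forall n, (n0 <= n)%N -> k * enorm (v n) ^+ 2 <= a n) ->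
  exists2 Q, 0 < Q &
    forall n, (n0 <= n)%N -> enorm (v n.+1) <= Q * c `^ (n%:R / 2).
Proof.
move=> /andP[c0 c1] k0 ac av.
have a_ge0 n : (n0 <= n)%N -> 0 <= a n.
  by move=> /av; apply: le_trans; rewrite mulr_ge0 ?sqr_ge0// ltW.
pose K := a n0 / (k * c ^+ n0).
have K0 : 0 <= K by rewrite divr_ge0 ?a_ge0// mulr_ge0 ?exprn_ge0 ?ltW.
(* The summand [1] keeps the constant positive when [a n0 = 0]. *)
exists (Num.sqrt K + 1) => [|n n0n]; first by rewrite ltr_wpDl ?sqrtr_ge0.
have pE : c `^ (n%:R / 2) = Num.sqrt (c ^+ n).
  by rewrite powRrM powR_mulrn ?ltW// powR12_sqrt// exprn_ge0 ?ltW.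
have v_le : enorm (v n.+1) ^+ 2 <= K * c ^+ n.
  rewrite -(ler_pM2l k0); apply: (le_trans (av _ (leqW n0n))).
  apply: (le_trans (ac _ n0n)); apply: (@le_trans _ _ (a n)).
    by rewrite ler_piMl ?a_ge0// ltW.
  apply: (le_trans (geometric_decay (ltW c0) ac n0n)).
  rewrite le_eqVlt; apply/orP; left; apply/eqP.
  rewrite -[in RHS](subnK n0n) exprD /K; field.
  by rewrite (lt0r_neq0 k0) expf_neq0 ?lt0r_neq0.
have -> : enorm (v n.+1) = Num.sqrt (enorm (v n.+1) ^+ 2).
  by rewrite sqrtr_sqr ger0_norm// sqrtr_ge0.
apply: (le_trans (ler_wsqrtr v_le)); rewrite sqrtrM// pE ler_wpM2r ?sqrtr_ge0//.
by rewrite lerDl.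
Qed.

End Rate.

(** * The convergence theorem *)

Theorem theorem7 (R : realType) (d m s : nat)
  (p : 'I_m -> nat) (q : 'I_s -> nat)
  (g : forall k : 'I_m, 'I_(p k).+1 -> 'rV[R]_d -> R)
  (u : forall l : 'I_s, 'I_(q l).+1 -> 'rV[R]_d -> R)
  (m0 M : R) (mu : nat -> \bar R) (mu_lim astar : \bar R)
  (x : nat -> 'rV[R]_d) (xstar : 'rV[R]_d) :
  (0 < m + s)%N ->
  (forall k i, twice_continuously_differentiable (g k i)) ->
  (forall l j, twice_continuously_differentiable (u l j)) ->
  0 < m0 -> m0 < M ->
  (forall k i, hessian_bounds m0 M (g k i)) ->
  (forall l j, hessian_bounds m0 M (u l j)) ->
  (1 <= astar)%E ->
  mu @ \oo --> mu_lim -> (0 < mu_lim)%E ->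
  QR_MCD g u (fun=> +oo%E) mu astar x ->
  x @ \oo --> xstar ->
  strict_local_min (objective g u) xstar /\
  exists (c Q : R) (n0 : nat),
    [/\ 0 < c < 1, 0 < Q &
     forall n, (n0 <= n)%N ->
       objective g u (x n.+1) - objective g u xstar
         <= c * (objective g u (x n) - objective g u xstar) /\
       enorm (x n.+1 - xstar) <= Q * c `^ (n%:R / 2)].
Proof.
move=> ms0 gC uC m0_gt0 m0M gH uH astar1 mu_cvg mu_lim0 method x_cvg.
set f := objective g u.
pose N : R := (m + s)%:R.
have N0 : 0 < N by rewrite ltr0n.
have [t [r [t01 tNM r01 rNm]]] : exists t r : R,
    [/\ 0 < t <= 1, t * (N * M) <= 1, 0 < r < 1 & r <= N * m0].
  by apply: step_sizes_exist; rewrite mulr_gt0// (lt_trans m0_gt0).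
have /andP[t0 t1] := t01; have /andP[r0 r1] := r01.
have step n j y : (forall l, min_indices u (mu n) l (x n) (j l)) ->
    f (x n.+1) <= (1 - t * r) * branch g u j (x n) + t * r * branch g u j y.
  move=> jn; apply: (QR_MCD_step gC uC gH uH y astar1 method jn) => //.
    by rewrite ltW.
  by rewrite !ltW.
have f_cvg : f (x n) @[n --> \oo] --> f xstar.
  have f_cont : {for xstar, continuous f} by exact: continuous_objective.
  exact: (cvg_comp _ _ x_cvg f_cont).
have fS_cvg : f (x n.+1) @[n --> \oo] --> f xstar.
  by rewrite (cvg_shiftS (fun n => f (x n))).
have star_min j : active u j xstar -> forall y, f xstar <= branch g u j y.
  move=> jx y.
  have b_cont : {for xstar, continuous (branch g u j)} by exact: continuous_branch.
  have b_cvg := cvg_comp _ _ x_cvg b_cont.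
  have : f xstar <= (1 - t * r) * branch g u j xstar + t * r * branch g u j y.
    have step_cvg : (1 - t * r) * branch g u j (x n) + t * r * branch g u j y
        @[n --> \oo] --> (1 - t * r) * branch g u j xstar + t * r * branch g u j y.
      apply: cvgD; last exact: cvg_cst.
      by apply: cvgM; [exact: cvg_cst|exact: b_cvg].
    apply: (ler_cvg_to fS_cvg step_cvg).
    have := near_min_indices uC mu_cvg mu_lim0 x_cvg.
    by apply: filterS => n jn; exact/step/jn.
  rewrite (active_branch g jx) -/f => fle.
  have : t * r * f xstar <= t * r * branch g u j y by lra.
  by rewrite ler_pM2l// mulr_gt0.
have growth : \forall y \near xstar,
    f xstar + N * m0 / 4 * enorm (y - xstar) ^+ 2 <= f y.
  have := near_active uC xstar; apply: filterS => y act.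
  have [j jy] := active_exists u y.
  rewrite /f -(active_branch g jy).
  have jx := act _ jy.
  exact: (min_branch_growth gC uC gH uH m0_gt0 m0M jx (star_min _ jx) y).
have k0 : 0 < N * m0 / 4 by rewrite divr_gt0// mulr_gt0.
split.
  rewrite /strict_local_min near_withinE; apply: filterS growth => y y_ge yx.
  by apply: lt_le_trans y_ge; rewrite ltrDl mulr_gt0// sqr_enorm_gt0// subr_eq0.
have [n0 _ n0P] : \forall n \near \oo,
    f xstar + N * m0 / 4 * enorm (x n - xstar) ^+ 2 <= f (x n) /\
    forall j, active u j (x n) -> active u j xstar.
  exact: (x_cvg _ (filterI growth (near_active uC xstar))).
have rate n : (n0 <= n)%N ->
    f (x n.+1) - f xstar <= (1 - t * r) * (f (x n) - f xstar).
  move=> /n0P[_ act]; have [j jx] := active_exists u (x n).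
  have /(_ xstar) := step n j _ _.
  rewrite (active_branch g jx) (active_branch g (act _ jx)) -/f => fle.
  suff : f (x n.+1) <= (1 - t * r) * f (x n) + t * r * f xstar by lra.
  apply: fle => l; rewrite /min_indices/= jx leeDl//.
  by have [_ + _ _] := method; apply.
have c01 : 0 < 1 - t * r < 1.
  have tr_lt1 : t * r < 1 by apply: le_lt_trans r1; rewrite ler_piMl// ltW.
  by rewrite subr_gt0 tr_lt1 gtrBl mulr_gt0.
have [Q Q0 QP] : exists2 Q, 0 < Q & forall n, (n0 <= n)%N ->
    enorm (x n.+1 - xstar) <= Q * (1 - t * r) `^ (n%:R / 2).
  apply: (linear_rate (v := fun n => x n - xstar) c01 k0 rate) => n /n0P[+ _].
  by rewrite lerBrDl.
by exists (1 - t * r), Q, n0; split => // n n0n; split; [exact: rate|exact: QP].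
Qed.
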